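(* Let $q\ge 2$ be an integer and let $f\colon \mathbb{N}_0\to\mathbb{U}$ be a $q$-multiplicative sequence of Gelfond type, i.e. there exists $c>0$ such that $$\sup_{\alpha\in\mathbb{R}}\Big|\frac1N\sum_{n=0}^{N-1} f(n)e(n\alpha)\Big|\ll N^{-c}\qquad (N\ge 1).$$ Then for every integer $d\ge 1$ there exists $c_d>0$ such that $$\sup_{p\in\mathbb{R}[x],\ \deg p\le d}\Big|\frac1N\sum_{n=0}^{N-1} f(n)e(p(n))\Big|\ll N^{-c_d}\qquad (N\ge 1).$$
   Context: $\mathbb{N}_0=\{0,1,2,\dots\}$, $\mathbb{U}=\{z\in\mathbb{C}:|z|=1\}$, $e(t)=e^{2\pi i t}$. A sequence $f\colon\mathbb{N}_0\to\mathbb{U}$ is $q$-multiplicative if for all integers $t,m,n\ge 0$ with $m<q^t$ and $q^t\mid n$ one has $f(m+n)=f(m)f(n)$. The notation $X\ll Y$ means $|X|\le CY$ for some constant $C$ independent of $N$ (it may depend on $f$, $q$, $d$). *)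

(* Defs.v *)
From Stdlib Require Import Reals.
From Coquelicot Require Import Coquelicot.
Open Scope R_scope.

Definition e (t : R) : C := (cos (2 * PI * t), sin (2 * PI * t)).

Definition unimodular (f : nat -> C) : Prop := forall n, Cmod (f n) = 1.

Definition q_multiplicative (q : nat) (f : nat -> C) : Prop :=
  forall t m n : nat, (m < q ^ t)%nat -> Nat.divide (q ^ t) n ->
    f (m + n)%nat = (f m * f n)%C.

Fixpoint csum (N : nat) (g : nat -> C) : C :=
  match N with
  | O => 0%C
  | S N' => (csum N' g + g N')%C
  end.

Definition twisted_avg (f : nat -> C) (phi : R -> R) (N : nat) : C :=
  ((/ INR N)%R : C) * csum N (fun n => (f n * e (phi (INR n)))%C).

Definition poly_eval (d : nat) (a : nat -> R) (x : R) : R :=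
  sum_f_R0 (fun k => a k * x ^ k) d.

Definition gelfond_type (f : nat -> C) : Prop :=
  exists c : R, 0 < c /\ exists K : R,
    forall N : nat, (1 <= N)%nat -> forall alpha : R,
      Cmod (twisted_avg f (fun x => x * alpha) N) <= K * Rpower (INR N) (- c).

(* Main.v *)
(* Induction on the degree.  Split the variable as n = u + U v with U a power of q.  By
   Cauchy-Schwarz in v and then opening the square over u, u', the weights f(u) and f(U v) both
   disappear, leaving averages over v of e(p(u + U v) - p(u' + U v)), unweighted polynomial phases
   of degree d - 1 with leading coefficient d a_d U^(d-1) (u - u').  Iterating (now with f = 1)
   down to a geometric sum shows that if the sum of length N is not small, then B a_d is within
   N^(-1 + eps) of an integer A for some positive B <= N^eps.  Now cut [0, N) into blocks of length
   N^kappa, eps << kappa < 1/d.  There a_d s^d may be replaced by A s^d / B, whose phase is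
   B-periodic in s; expanding it in additive characters mod B costs a factor B and leaves phases
   of degree at most d - 1 (the characters only change the linear term, and d >= 2), so the
   induction hypothesis applies.  The Gelfond condition is the case d = 1. *)

Require Import Defs.
From Stdlib Require Import Reals Lra Lia ZArith Znumtheory Classical.
From Coquelicot Require Import Coquelicot.
Open Scope R_scope.

(** * Finite sums of complex and real numbers *)

Fixpoint rsum (N : nat) (g : nat -> R) : R :=
  match N with
  | O => 0
  | S N' => rsum N' g + g N'
  end.

Lemma csum_ext (N : nat) (g h : nat -> C) :
  (forall n, (n < N)%nat -> g n = h n) -> csum N g = csum N h.
Proof.
  induction N as [|N IH]; intros H; [reflexivity|].
  simpl. rewrite (H N) by lia. rewrite IH; [reflexivity|].
  intros; apply H; lia.
Qed.

Lemma csum_plus (N : nat) (g h : nat -> C) :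
  csum N (fun n => (g n + h n)%C) = (csum N g + csum N h)%C.
Proof.
  induction N as [|N IH]; simpl; [ring|]. rewrite IH; ring.
Qed.

Lemma csum_mult_l (N : nat) (z : C) (g : nat -> C) :
  csum N (fun n => (z * g n)%C) = (z * csum N g)%C.
Proof.
  induction N as [|N IH]; simpl; [ring|]. rewrite IH; ring.
Qed.

Lemma csum_mult_r (N : nat) (z : C) (g : nat -> C) :
  csum N (fun n => (g n * z)%C) = (csum N g * z)%C.
Proof.
  induction N as [|N IH]; simpl; [ring|]. rewrite IH; ring.
Qed.

Lemma csum_0 (N : nat) : csum N (fun _ => 0%C) = 0%C.
Proof.
  induction N as [|N IH]; simpl; [reflexivity|]. rewrite IH; ring.
Qed.

Lemma csum_1 (N : nat) : csum N (fun _ => 1%C) = INR N.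
Proof.
  induction N as [|N IH]; [reflexivity|].
  rewrite S_INR, RtoC_plus, <- IH. reflexivity.
Qed.

Lemma csum_conj (N : nat) (g : nat -> C) :
  Cconj (csum N g) = csum N (fun n => Cconj (g n)).
Proof.
  induction N as [|N IH]; simpl.
  - unfold Cconj, RtoC; simpl. f_equal; ring.
  - rewrite Cplus_conj, IH. reflexivity.
Qed.

Lemma csum_exchange (M N : nat) (g : nat -> nat -> C) :
  csum M (fun m => csum N (g m)) = csum N (fun n => csum M (fun m => g m n)).
Proof.
  induction M as [|M IH]; simpl.
  - now rewrite csum_0.
  - now rewrite IH, csum_plus.
Qed.

Lemma csum_add (M N : nat) (g : nat -> C) :
  csum (M + N) g = (csum M g + csum N (fun n => g (n + M)%nat))%C.
Proof.
  induction N as [|N IH]; simpl.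
  - rewrite Nat.add_0_r. ring.
  - rewrite Nat.add_succ_r. simpl. rewrite IH, (Nat.add_comm N M). ring.
Qed.

Lemma csum_mul (U V : nat) (g : nat -> C) :
  csum (V * U) g = csum V (fun v => csum U (fun u => g (u + v * U)%nat)).
Proof.
  induction V as [|V IH]; [reflexivity|].
  replace (S V * U)%nat with (V * U + U)%nat by lia.
  rewrite csum_add, IH. reflexivity.
Qed.

Lemma csum_single (N m : nat) (g : nat -> C) :
  (m < N)%nat -> (forall n, (n < N)%nat -> n <> m -> g n = 0%C) ->
  csum N g = g m.
Proof.
  induction N as [|N IH]; intros Hm H; [lia|]. simpl.
  destruct (Nat.eq_dec m N) as [->|Hne].
  - rewrite (csum_ext N g (fun _ => 0%C)), csum_0 by (intros; apply H; lia).
    ring.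
  - rewrite IH, (H N) by (intros; try apply H; lia). ring.
Qed.

Lemma rsum_le (N : nat) (g h : nat -> R) :
  (forall n, (n < N)%nat -> g n <= h n) -> rsum N g <= rsum N h.
Proof.
  induction N as [|N IH]; intros H; simpl; [lra|].
  apply Rplus_le_compat; [apply IH; intros; apply H|apply H]; lia.
Qed.

Lemma rsum_plus (N : nat) (g h : nat -> R) :
  rsum N (fun n => g n + h n) = rsum N g + rsum N h.
Proof.
  induction N as [|N IH]; simpl; [ring|]. rewrite IH; ring.
Qed.

Lemma rsum_const (N : nat) (x : R) : rsum N (fun _ => x) = INR N * x.
Proof.
  induction N as [|N IH]; [simpl; ring|]. rewrite S_INR. simpl. rewrite IH; ring.
Qed.

Lemma rsum_indicator (N m : nat) (x : R) :
  (m < N)%nat -> rsum N (fun n => if Nat.eq_dec m n then x else 0) = x.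
Proof.
  induction N as [|N IH]; intros Hm; [lia|]. simpl.
  destruct (Nat.eq_dec m N) as [->|Hne].
  - assert (H : rsum N (fun n => if Nat.eq_dec N n then x else 0) = rsum N (fun _ => 0)).
    { apply Rle_antisym; apply rsum_le; intros n Hn;
        (destruct (Nat.eq_dec N n); [lia|lra]). }
    rewrite H, rsum_const. ring.
  - rewrite IH by lia. ring.
Qed.

(** Cauchy-Schwarz against the constant sequence [1]. *)
Lemma rsum_sqr_le (N : nat) (g : nat -> R) :
  rsum N g ^ 2 <= INR N * rsum N (fun n => g n ^ 2).
Proof.
  assert (H0 : forall M h, (forall n, 0 <= h n) -> 0 <= rsum M h).
  { intros M h Hh; induction M as [|M IH]; simpl; [lra|]. specialize (Hh M); lra. }
  induction N as [|N IH]; [simpl; lra|].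
  rewrite S_INR. cbn [rsum].
  destruct N as [|N].
  - simpl. lra.
  - set (s := rsum (S N) g) in *. set (T := rsum (S N) (fun n => g n ^ 2)) in *.
    assert (HT : 0 <= T) by (apply H0; intros; apply pow2_ge_0).
    set (k := INR (S N)) in *.
    assert (Hk : 0 < k) by (apply lt_0_INR; lia).
    set (x := g (S N)).
    (* Since [s ^ 2 <= k * T], AM-GM gives [2 s x <= s^2 / k + k x^2 <= T + k x^2]. *)
    assert (H2 : 2 * s * x <= T + k * x ^ 2).
    { apply Rmult_le_reg_l with k; [lra|].
      assert (0 <= (s - k * x) ^ 2) by apply pow2_ge_0. nra. }
    nra.
Qed.

Lemma Cmod_csum_le (N : nat) (g : nat -> C) :
  Cmod (csum N g) <= rsum N (fun n => Cmod (g n)).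
Proof.
  induction N as [|N IH]; simpl.
  - rewrite Cmod_0; lra.
  - eapply Rle_trans; [apply Cmod_triangle|]. lra.
Qed.

Lemma Cmod_csum_bound (N : nat) (g : nat -> C) (x : R) :
  (forall n, (n < N)%nat -> Cmod (g n) <= x) -> Cmod (csum N g) <= INR N * x.
Proof.
  intros H. rewrite <- rsum_const.
  eapply Rle_trans; [apply Cmod_csum_le|]. now apply rsum_le.
Qed.

(** * The additive character *)

Lemma e_plus (x y : R) : e (x + y) = (e x * e y)%C.
Proof.
  unfold e, Cmult; simpl.
  replace (2 * PI * (x + y)) with (2 * PI * x + 2 * PI * y) by ring.
  rewrite cos_plus, sin_plus. f_equal; ring.
Qed.

Lemma e_conj (x : R) : Cconj (e x) = e (- x).
Proof.
  unfold e, Cconj; simpl.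
  replace (2 * PI * - x) with (- (2 * PI * x)) by ring.
  now rewrite cos_neg, sin_neg.
Qed.

Lemma Cmod_e (x : R) : Cmod (e x) = 1.
Proof.
  unfold Cmod, e; simpl.
  replace (_ + _) with ((sin (2 * PI * x))² + (cos (2 * PI * x))²)
    by (unfold Rsqr; ring).
  rewrite sin2_cos2. apply sqrt_1.
Qed.

Lemma e_0 : e 0 = 1%C.
Proof.
  unfold e. rewrite Rmult_0_r, cos_0, sin_0. reflexivity.
Qed.

Lemma e_INR (n : nat) : e (INR n) = 1%C.
Proof.
  unfold e. replace (2 * PI * INR n) with (0 + 2 * INR n * PI) by ring.
  rewrite cos_period, sin_period, cos_0, sin_0. reflexivity.
Qed.

Lemma e_IZR (k : Z) : e (IZR k) = 1%C.
Proof.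
  destruct (Z_le_gt_dec 0 k) as [Hk|Hk].
  - rewrite <- (Z2Nat.id k Hk), <- INR_IZR_INZ. apply e_INR.
  - rewrite <- (Z.opp_involutive k), opp_IZR, <- e_conj.
    rewrite <- (Z2Nat.id (- k)) by lia. rewrite <- INR_IZR_INZ, e_INR.
    unfold Cconj, RtoC; simpl. f_equal; ring.
Qed.

Lemma e_shift_IZR (x : R) (k : Z) : e (x - IZR k) = e x.
Proof.
  unfold Rminus. rewrite <- opp_IZR, e_plus, e_IZR. ring.
Qed.

(** Factoring out [e y] leaves [|e z - 1|] with [z = x - y], whose square is
    [2 - 2 cos (2 PI z) = 4 sin (PI z) ^ 2]. *)
Lemma Cmod_e_minus (x y : R) :
  Cmod (e x - e y) = 2 * Rabs (sin (PI * (x - y))).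
Proof.
  replace (e x - e y)%C with (e y * (e (x - y) - 1))%C.
  2:{ unfold Cminus. rewrite Cmult_plus_distr_l, <- e_plus.
      replace (y + (x - y)) with x by ring. ring. }
  rewrite Cmod_mult, Cmod_e, Rmult_1_l.
  set (z := x - y).
  apply Rsqr_inj; [apply Cmod_ge_0|pose proof (Rabs_pos (sin (PI * z))); lra|].
  rewrite Rsqr_mult, <- Rsqr_abs. unfold Rsqr.
  replace (Cmod (e z - 1) * Cmod (e z - 1)) with (Cmod (e z - 1) ^ 2) by ring.
  rewrite Cmod2_alt. unfold e; simpl.
  replace (2 * PI * z) with (2 * (PI * z)) by ring.
  rewrite cos_2a_sin, sin_2a.
  pose proof (sin2_cos2 (PI * z)) as H. unfold Rsqr in H.
  set (s := sin _) in *. set (c := cos _) in *.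
  nra.
Qed.

(** The constant [8] comes from [|sin z| <= |z|] and the crude bound [PI <= 4]. *)
Lemma e_lipschitz (x y : R) : Cmod (e x - e y) <= 8 * Rabs (x - y).
Proof.
  rewrite Cmod_e_minus.
  assert (Hsin : forall z, Rabs (sin z) <= Rabs z).
  { assert (Hpos : forall z, 0 <= z -> Rabs (sin z) <= z).
    { intros z Hz. apply Rabs_le. destruct Hz as [Hz| <-].
      - split; [|left; now apply sin_lt_x].
        assert (H := sin_gt_x (- z)). rewrite sin_neg in H.
        destruct (Rle_dec z 1).
        + assert (0 <= sin z); [apply sin_ge_0; pose proof PI2_1; lra|lra].
        + pose proof (SIN_bound z); lra.
      - rewrite sin_0; lra. }
    intros z. destruct (Rle_dec 0 z) as [Hz|Hz].
    - rewrite (Rabs_pos_eq z Hz). now apply Hpos.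
    - rewrite <- (Rabs_Ropp z), (Rabs_pos_eq (- z)) by lra.
      rewrite <- Rabs_Ropp, <- sin_neg. apply Hpos; lra. }
  specialize (Hsin (PI * (x - y))).
  rewrite Rabs_mult, (Rabs_pos_eq PI) in Hsin by (pose proof PI_RGT_0; lra).
  pose proof PI_4. pose proof (Rabs_pos (x - y)). nra.
Qed.

Lemma e_minus_1_lower (x : R) :
  Rabs x <= 1 / 2 -> 2 * Rabs x <= Cmod (e x - 1).
Proof.
  intros Hx. rewrite <- e_0, Cmod_e_minus, Rminus_0_r.
  apply Rmult_le_compat_l; [lra|].
  assert (Hpos : forall z, 0 <= z <= 1 / 2 -> z <= sin (PI * z)).
  { intros z Hz. pose proof PI_4. pose proof PI2_3_2. pose proof PI_RGT_0.
    (* With [w = PI * z] in [[0, 2]], the cubic Taylor bound gives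
       [sin w >= w - w ^ 3 / 6 >= w / 3 >= z]. *)
    assert (Hb := sin_bound (PI * z) 0).
    destruct Hb as [Hb _]; [nra|nra|].
    unfold sin_approx, sin_term in Hb. simpl in Hb.
    set (w := PI * z) in *.
    assert (Hw : 0 <= w <= 2) by (unfold w; nra).
    assert (w - w * w * w / 6 <= sin w) by lra.
    assert (3 * z <= w) by (unfold w; nra).
    nra. }
  destruct (Rle_dec 0 x) as [H|H].
  - rewrite (Rabs_pos_eq x) in * by lra. rewrite Rabs_pos_eq.
    + apply Hpos; lra.
    + specialize (Hpos x); lra.
  - rewrite (Rabs_left x) in * by lra.
    rewrite <- (Rabs_Ropp (sin _)), <- sin_neg, Ropp_mult_distr_r.
    rewrite Rabs_pos_eq.
    + apply Hpos; lra.
    + specialize (Hpos (- x)); lra.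
Qed.

(** The multiplied-out form covers [e x = 1] without exception. *)
Lemma csum_e_geometric (N : nat) (x : R) :
  ((e x - 1) * csum N (fun n => e (x * INR n)) = e (x * INR N) - 1)%C.
Proof.
  induction N as [|N IH].
  - simpl. rewrite Rmult_0_r, e_0. ring.
  - rewrite S_INR. cbn [csum]. rewrite Cmult_plus_distr_l, IH.
    rewrite Rmult_plus_distr_l, Rmult_1_r, e_plus. ring.
Qed.

Lemma exists_nearest_IZR (x : R) : exists k : Z, Rabs (x - IZR k) <= 1 / 2.
Proof.
  exists (Int_part (x + 1 / 2)).
  pose proof (base_Int_part (x + 1 / 2)) as [H1 H2].
  apply Rabs_le. lra.
Qed.

(** Take [k] nearest to [x]: the geometric sum times [|e x - 1|] is at most [2], while
    [|e x - 1| >= 2 |x - k|]. The same [k] serves every [N]. *)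
Lemma linear_sum_bound (x y : R) :
  exists k : Z, forall N : nat,
    Rabs (x - IZR k) * Cmod (csum N (fun n => e (x * INR n + y))) <= 1.
Proof.
  destruct (exists_nearest_IZR x) as [k Hk].
  exists k. intros N.
  assert (Hlow := e_minus_1_lower _ Hk). rewrite e_shift_IZR in Hlow.
  rewrite (csum_ext N _ (fun n => (e (x * INR n) * e y)%C))
    by (intros; apply e_plus).
  rewrite csum_mult_r, Cmod_mult, Cmod_e, Rmult_1_r.
  assert (Hg := csum_e_geometric N x).
  apply (f_equal Cmod) in Hg. rewrite Cmod_mult in Hg.
  assert (Hup : Cmod (e (x * INR N) - 1) <= 2).
  { rewrite <- e_0, Cmod_e_minus.
    assert (Rabs (sin (PI * (x * INR N - 0))) <= 1)
      by (apply Rabs_le, SIN_bound). lra. }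
  pose proof (Cmod_ge_0 (csum N (fun n => e (x * INR n)))).
  nra.
Qed.

Lemma csum_e_orthogonality (B : nat) (m : Z) :
  (0 < B)%nat ->
  csum B (fun j => e (IZR m / INR B * INR j)) =
  (if Zdivide_dec (Z.of_nat B) m then RtoC (INR B) else 0%C).
Proof.
  intros HB.
  assert (HB' : INR B <> 0) by (apply not_0_INR; lia).
  destruct (Zdivide_dec (Z.of_nat B) m) as [[k ->]|Hnd].
  - rewrite (csum_ext B _ (fun _ => 1%C)), csum_1; [reflexivity|].
    intros n _. rewrite mult_IZR, <- INR_IZR_INZ.
    replace (IZR k * INR B / INR B * INR n) with (IZR (k * Z.of_nat n)).
    + apply e_IZR.
    + rewrite mult_IZR, <- INR_IZR_INZ. now field.
  - assert (Hg := csum_e_geometric B (IZR m / INR B)).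
    replace (IZR m / INR B * INR B) with (IZR m) in Hg by now field.
    rewrite e_IZR in Hg. unfold Cminus at 2 in Hg. rewrite Cplus_opp_r in Hg.
    destruct (Ceq_dec (csum B (fun n => e (IZR m / INR B * INR n))) 0) as [H|H]; [exact H|].
    exfalso.
    assert (He : (e (IZR m / INR B) - 1)%C = 0%C).
    { destruct (Ceq_dec (e (IZR m / INR B) - 1)%C 0%C) as [H'|H']; [exact H'|].
      exfalso. revert Hg. now apply Cmult_neq_0. }
    (* If [e (m / B) = 1], the lower bound for [|e x - 1|] puts [m / B] at distance [0] from an
       integer, so [B] divides [m]. *)
    destruct (exists_nearest_IZR (IZR m / INR B)) as [k Hk].
    assert (Hlow := e_minus_1_lower _ Hk).
    rewrite e_shift_IZR, He, Cmod_0 in Hlow.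
    assert (H0 : IZR m / INR B - IZR k = 0).
    { pose proof (Rabs_pos (IZR m / INR B - IZR k)).
      apply Rabs_eq_0. lra. }
    apply Hnd. exists k. apply eq_IZR. rewrite mult_IZR, <- INR_IZR_INZ.
    replace (IZR k) with (IZR m / INR B) by lra. now field.
Qed.

(** * Polynomial functions of bounded degree *)

(* [b] is the coefficient of [x ^ D] and may be [0], so [D] only bounds the degree. *)
Fixpoint poly_deg (D : nat) (b : R) (P : R -> R) : Prop :=
  match D with
  | O => forall x, P x = b
  | S D' => exists c Q, poly_deg D' c Q /\ forall x, P x = b * x ^ D + Q x
  end.

Lemma poly_deg_ext (D : nat) (b : R) (P Q : R -> R) :
  (forall x, P x = Q x) -> poly_deg D b P -> poly_deg D b Q.
Proof.
  destruct D as [|D]; simpl; intros H.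
  - intros HP x. now rewrite <- H.
  - intros (c & T & HT & HP). exists c, T. split; [exact HT|].
    intros x. now rewrite <- H.
Qed.

Lemma poly_deg_lin_comb (D : nat) (b c k : R) (P Q : R -> R) :
  poly_deg D b P -> poly_deg D c Q -> poly_deg D (b + k * c) (fun x => P x + k * Q x).
Proof.
  revert b c P Q; induction D as [|D IH]; simpl; intros b c P Q HP HQ.
  - intros x. now rewrite HP, HQ.
  - destruct HP as (b' & P' & HP' & HP), HQ as (c' & Q' & HQ' & HQ).
    exists (b' + k * c'), (fun x => P' x + k * Q' x). split; [now apply IH|].
    intros x. rewrite HP, HQ. ring.
Qed.

(** Used to absorb additive characters into a phase of lower degree. The leading coefficient is
    existential because it is [k] for [D = 0] and [0] otherwise. *)
Lemma poly_deg_linear (D : nat) (k : R) :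
  exists b, poly_deg (S D) b (fun x => k * x).
Proof.
  induction D as [|D [b IH]].
  - exists k, 0, (fun _ => 0). split; [now intros x|]. intros; simpl; ring.
  - exists 0, b, (fun x => k * x). split; [exact IH|]. intros; ring.
Qed.

Lemma poly_deg_mul_id (D : nat) (b : R) (P : R -> R) :
  poly_deg D b P -> poly_deg (S D) b (fun x => x * P x).
Proof.
  revert b P; induction D as [|D IH]; intros b P HP.
  - exists 0, (fun _ => 0). split; [now intros x|].
    intros x. rewrite (HP x). simpl. ring.
  - destruct HP as (c & Q & HQ & HP). exists c, (fun x => x * Q x).
    split; [now apply IH|]. intros x. rewrite HP. simpl. ring.
Qed.

(** The binomial theorem, keeping track of the top two coefficients only. *)
Lemma poly_deg_pow_shift (D : nat) (h : R) :
  exists T, poly_deg D (INR (S D) * h) T /\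
    forall x, (x + h) ^ S D = x ^ S D + T x.
Proof.
  induction D as [|D (T & HT & IH)].
  - exists (fun _ => h). split; intros x; simpl; ring.
  - exists (fun x => (x * T x) + h * (x + h) ^ S D). split.
    + replace (INR (S (S D)) * h) with (INR (S D) * h + h * 1)
        by (rewrite (S_INR (S D)); ring).
      apply poly_deg_lin_comb; [now apply poly_deg_mul_id|].
      exists (INR (S D) * h), T. split; [exact HT|]. intros x. rewrite IH. ring.
    + intros x. rewrite <- tech_pow_Rmult. rewrite Rmult_plus_distr_r.
      rewrite IH at 1. rewrite <- (tech_pow_Rmult x (S D)). ring.
Qed.

Lemma poly_deg_shift (D : nat) (b h : R) (P : R -> R) :
  poly_deg D b P -> poly_deg D b (fun x => P (x + h)).
Proof.
  revert b P; induction D as [|D IH]; intros b P HP.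
  - intros x. apply HP.
  - destruct HP as (c & Q & HQ & HP).
    destruct (poly_deg_pow_shift D h) as (T & HT & Hpow).
    exists (c + b * (INR (S D) * h)), (fun x => Q (x + h) + b * T x).
    split; [apply poly_deg_lin_comb; [now apply IH|exact HT]|].
    intros x. rewrite HP, Hpow. ring.
Qed.

(** The terms [b * x ^ S D] cancel, and so does the next coefficient [c]; at degree [D] only the
    binomial contributions of [h] and [k] survive. *)
Lemma poly_deg_difference (D : nat) (b h k : R) (P : R -> R) :
  poly_deg (S D) b P ->
  poly_deg D (INR (S D) * b * (h - k)) (fun x => P (x + h) - P (x + k)).
Proof.
  intros (c & Q & HQ & HP).
  destruct (poly_deg_pow_shift D h) as (T & HT & HTpow).
  destruct (poly_deg_pow_shift D k) as (W & HW & HWpow).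
  apply (poly_deg_ext D _
    (fun x => (Q (x + h) + b * T x) + (-1) * (Q (x + k) + b * W x))).
  - intros x. rewrite !HP, HTpow, HWpow. ring.
  - replace (INR (S D) * b * (h - k)) with
      ((c + b * (INR (S D) * h)) + (-1) * (c + b * (INR (S D) * k))) by ring.
    apply poly_deg_lin_comb; apply poly_deg_lin_comb; try assumption;
      now apply poly_deg_shift.
Qed.

Lemma poly_deg_dilate (D : nat) (b k : R) (P : R -> R) :
  poly_deg D b P -> poly_deg D (b * k ^ D) (fun x => P (k * x)).
Proof.
  revert b P; induction D as [|D IH]; intros b P HP.
  - intros x. rewrite (HP (k * x)). simpl. ring.
  - destruct HP as (c & Q & HQ & HP). exists (c * k ^ D), (fun x => Q (k * x)).
    split; [now apply IH|]. intros x. rewrite HP, Rpow_mult_distr. ring.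
Qed.

Lemma poly_deg_poly_eval (d : nat) (a : nat -> R) : poly_deg d (a d) (poly_eval d a).
Proof.
  induction d as [|d IH].
  - intros x. unfold poly_eval. simpl. ring.
  - exists (a d), (poly_eval d a). split; [exact IH|].
    intros x. unfold poly_eval. rewrite tech5. ring.
Qed.

(** * Phases that are periodic in the summation variable *)

(** Congruence of powers modulo [B], stated in the reals so that it applies inside [e]. *)
Lemma pow_congruent (B r k d : nat) :
  exists m : Z, INR (r + k * B) ^ d = INR r ^ d + IZR m * INR B.
Proof.
  induction d as [|d [m IH]].
  - exists 0%Z. simpl. ring.
  - exists (Z.of_nat r * m + Z.of_nat k * Z.of_nat r ^ Z.of_nat d
            + Z.of_nat k * m * Z.of_nat B)%Z.
    rewrite <- tech_pow_Rmult, IH, !plus_IZR, !mult_IZR, <- pow_IZR, <- !INR_IZR_INZ.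
    rewrite plus_INR, mult_INR. simpl. ring.
Qed.

(** Fourier expansion modulo [B]: the left side depends only on [s mod B], and by orthogonality the
    sum over [j] singles out [r = s mod B]. *)
Lemma rational_phase_expansion (B d s : nat) (A : Z) :
  (0 < B)%nat ->
  e (IZR A / INR B * INR s ^ d) =
  csum B (fun r => csum B (fun j =>
    (/ INR B * e (IZR A / INR B * INR r ^ d - INR r * INR j / INR B)
     * e (INR j / INR B * INR s))%C)).
Proof.
  intros HB.
  assert (HB' : INR B <> 0) by (apply not_0_INR; lia).
  rewrite (csum_ext B _ (fun r => (/ INR B * e (IZR A / INR B * INR r ^ d)
    * (if Zdivide_dec (Z.of_nat B) (Z.of_nat s - Z.of_nat r)
       then RtoC (INR B) else 0%C))%C)).
  2:{ intros r _. rewrite <- csum_e_orthogonality, <- csum_mult_l by exact HB.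
      apply csum_ext; intros j _. rewrite <- !Cmult_assoc, <- !e_plus.
      do 2 f_equal. rewrite minus_IZR, <- !INR_IZR_INZ. now field. }
  rewrite (csum_single B (s mod B)).
  - destruct (Zdivide_dec _ _) as [_|Hn].
    + destruct (pow_congruent B (s mod B) (s / B) d) as [m Hm].
      replace (s mod B + s / B * B)%nat with s in Hm
        by (rewrite (Nat.div_mod_eq s B) at 1; lia).
      rewrite Hm.
      replace (IZR A / INR B * (INR (s mod B) ^ d + IZR m * INR B))
        with (IZR A / INR B * INR (s mod B) ^ d + IZR (A * m)).
      * rewrite e_plus, e_IZR. field. intros H. apply HB'. now apply RtoC_inj.
      * rewrite mult_IZR. now field.
    + exfalso. apply Hn. exists (Z.of_nat (s / B)).
      rewrite (Nat.div_mod_eq s B) at 1. lia.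
  - apply Nat.mod_upper_bound. lia.
  - intros r Hr Hne. destruct (Zdivide_dec _ _) as [[k Hk]|_]; [|ring].
    exfalso. apply Hne.
    apply Nat2Z.inj. rewrite Nat2Z.inj_mod.
    apply Z.mod_unique with k; lia.
Qed.

(** The expansion has [B ^ 2] terms with coefficients of modulus [1 / B], so the loss is a factor
    [B]. *)
Lemma rational_phase_bound (N B d : nat) (A : Z) (g : nat -> C) (X : R) :
  (0 < B)%nat ->
  (forall j : nat, Cmod (csum N (fun s => (g s * e (INR j / INR B * INR s))%C)) <= X) ->
  Cmod (csum N (fun s => (g s * e (IZR A / INR B * INR s ^ d))%C)) <= INR B * X.
Proof.
  intros HB HX.
  assert (HB' : 0 < INR B) by (apply lt_0_INR; lia).
  rewrite (csum_ext N _ (fun s => csum B (fun r => csum B (fun j =>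
    (/ INR B * e (IZR A / INR B * INR r ^ d - INR r * INR j / INR B)
     * (g s * e (INR j / INR B * INR s)))%C)))).
  2:{ intros s _. rewrite rational_phase_expansion, <- csum_mult_l by exact HB.
      apply csum_ext; intros r _. rewrite <- csum_mult_l.
      apply csum_ext; intros j _. ring. }
  rewrite csum_exchange.
  apply Cmod_csum_bound. intros r _.
  rewrite csum_exchange.
  replace X with (INR B * (/ INR B * X)) by (field; lra).
  apply Cmod_csum_bound. intros j _.
  rewrite csum_mult_l, !Cmod_mult, Cmod_e, Rmult_1_r.
  rewrite <- RtoC_inv, Cmod_R, Rabs_pos_eq
    by first [lra | left; now apply Rinv_0_lt_compat].
  apply Rmult_le_compat_l; [left; now apply Rinv_0_lt_compat|apply HX].
Qed.

(** * Differencing *)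

(* Cauchy-Schwarz in [v] removes the factor [f (v * U)], expanding the square and
   exchanging the sums then removes the factor [f u]. *)
Lemma van_der_corput (U V : nat) (f : nat -> C) (P : nat -> R) :
  unimodular f ->
  (forall u v, (u < U)%nat -> f (u + v * U)%nat = (f u * f (v * U)%nat)%C) ->
  Cmod (csum (V * U) (fun n => (f n * e (P n))%C)) ^ 2 <=
  INR V * rsum U (fun u => rsum U (fun w =>
    Cmod (csum V (fun v => e (P (u + v * U)%nat - P (w + v * U)%nat))))).
Proof.
  intros Hu Hmul.
  set (Y := fun v => csum U (fun u => (f u * e (P (u + v * U)%nat))%C)).
  rewrite csum_mul.
  rewrite (csum_ext V _ (fun v => (f (v * U)%nat * Y v)%C)).
  2:{ intros v _. unfold Y. rewrite <- csum_mult_l.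
      apply csum_ext. intros u Hlt. rewrite Hmul by exact Hlt. ring. }
  apply Rle_trans with (rsum V (fun v => Cmod (Y v)) ^ 2).
  { apply pow_incr. split; [apply Cmod_ge_0|].
    eapply Rle_trans; [apply Cmod_csum_le|]. apply rsum_le. intros v _.
    rewrite Cmod_mult, Hu. lra. }
  eapply Rle_trans; [apply rsum_sqr_le|].
  apply Rmult_le_compat_l; [apply pos_INR|].
  assert (Hsq : RtoC (rsum V (fun v => Cmod (Y v) ^ 2)) =
    csum U (fun u => csum U (fun w => (f u * Cconj (f w) *
      csum V (fun v => e (P (u + v * U)%nat - P (w + v * U)%nat)))%C))).
  { transitivity (csum V (fun v => (Y v * Cconj (Y v))%C)).
    - clear. induction V as [|V IH]; [reflexivity|].
      cbn [rsum csum]. rewrite RtoC_plus, IH. f_equal.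
      rewrite <- Cmod2_conj. reflexivity.
    - rewrite (csum_ext V _ (fun v => csum U (fun u => csum U (fun w =>
        (f u * Cconj (f w) * e (P (u + v * U)%nat - P (w + v * U)%nat))%C)))).
      + rewrite csum_exchange. apply csum_ext; intros u _.
        rewrite csum_exchange. apply csum_ext; intros w _.
        apply csum_mult_l.
      + intros v _. unfold Y. rewrite csum_conj, <- csum_mult_r.
        apply csum_ext; intros u _. rewrite <- csum_mult_l.
        apply csum_ext; intros w _. rewrite Cmult_conj, e_conj.
        unfold Rminus. rewrite e_plus. ring. }
  eapply Rle_trans; [apply Rle_abs|]. rewrite <- Cmod_R, Hsq.
  eapply Rle_trans; [apply Cmod_csum_le|]. apply rsum_le; intros u _.
  eapply Rle_trans; [apply Cmod_csum_le|]. apply rsum_le; intros w _.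
  rewrite !Cmod_mult, Cmod_conj, !Hu. lra.
Qed.

Lemma q_multiplicative_block (q : nat) (f : nat -> C) (t u v : nat) :
  q_multiplicative q f -> (u < q ^ t)%nat ->
  f (u + v * q ^ t)%nat = (f u * f (v * q ^ t)%nat)%C.
Proof.
  intros Hf Hu. apply (Hf t); [exact Hu|]. now exists v.
Qed.

(** Let [U = q ^ (4 * t)] and [q ^ L = V * U]. If all correlations with [u <> w] were below [V / U],
    diagonal and off-diagonal pairs would contribute at most [U V] each, so the squared sum would be
    at most [2 U V ^ 2]. The assumed size at least [U V / q ^ t] would then force
    [U <= 2 q ^ (2 t)], which is false. So some [h = u - w] gives a large unweighted sum. *)
Lemma differencing (q : nat) (f : nat -> C) (D t L : nat) (b : R) (P : R -> R) :
  (2 <= q)%nat -> unimodular f -> q_multiplicative q f ->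
  (1 <= t)%nat -> (4 * t <= L)%nat -> poly_deg (S D) b P ->
  INR q ^ L <= INR q ^ t * Cmod (csum (q ^ L) (fun n => (f n * e (P (INR n)))%C)) ->
  exists h : Z, h <> 0%Z /\ Rabs (IZR h) <= INR q ^ (4 * t) /\
  exists T, poly_deg D (INR (S D) * b * IZR h * (INR q ^ (4 * t)) ^ D) T /\
    INR q ^ (L - 4 * t) <=
      INR q ^ (4 * t) * Cmod (csum (q ^ (L - 4 * t)) (fun v => e (T (INR v)))).
Proof.
  intros Hq Hu Hf Ht HL HP Hlarge.
  assert (HQ : 2 <= INR q) by (change 2 with (INR 2); now apply le_INR).
  rewrite <- !pow_INR in *.
  set (U := (q ^ (4 * t))%nat) in *. set (V := (q ^ (L - 4 * t))%nat) in *.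
  assert (HqL : (q ^ L = V * U)%nat).
  { unfold U, V. rewrite <- Nat.pow_add_r. f_equal. lia. }
  assert (HU : 0 < INR U) by (unfold U; rewrite pow_INR; apply pow_lt; lra).
  assert (HV : 0 < INR V) by (unfold V; rewrite pow_INR; apply pow_lt; lra).
  set (Z := fun u w => csum V (fun v => e (P (INR (u + v * U)) - P (INR (w + v * U))))).
  destruct (classic (exists u w, (u < U)%nat /\ (w < U)%nat /\ u <> w /\
    INR V <= INR U * Cmod (Z u w))) as [(u & w & Hu1 & Hw1 & Hne & HZ)|Hno].
  - exists (Z.of_nat u - Z.of_nat w)%Z. split; [lia|].
    rewrite minus_IZR, <- !INR_IZR_INZ. split.
    { apply lt_INR in Hu1, Hw1. pose proof (pos_INR u). pose proof (pos_INR w).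
      apply Rabs_le. lra. }
    (* Dilating the variable by [U] multiplies the leading coefficient of the difference by
       [U ^ D]. *)
    exists (fun x => P (INR U * x + INR u) - P (INR U * x + INR w)). split.
    + rewrite (pow_INR U D).
      apply (poly_deg_dilate D _ (INR U) (fun y => P (y + INR u) - P (y + INR w))).
      now apply poly_deg_difference.
    + unfold Z in HZ. erewrite csum_ext; [exact HZ|].
      intros v _. cbv beta. rewrite !plus_INR, mult_INR.
      do 2 f_equal; f_equal; ring.
  - exfalso.
    assert (Hcs := van_der_corput U V f (fun n => P (INR n)) Hu
      (fun u v => q_multiplicative_block q f (4 * t) u v Hf)).
    cbv beta in Hcs. rewrite HqL in Hlarge.
    set (S0 := Cmod (csum (V * U) _)) in *.
    assert (Hsum : rsum U (fun u => rsum U (fun w => Cmod (Z u w))) <=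
      INR U * (INR V + INR U * (INR V / INR U))).
    { rewrite <- rsum_const. apply rsum_le. intros u Hu1.
      (* For fixed [u], the majorant is [V] at [w = u] plus [V / U] at every [w]. *)
      rewrite <- rsum_const, <- (rsum_indicator U u (INR V)), <- rsum_plus by exact Hu1.
      rewrite (rsum_indicator U u (INR V)) by exact Hu1.
      apply rsum_le. intros w Hw1.
      assert (HVU : 0 < INR V / INR U) by now apply Rdiv_lt_0_compat.
      destruct (Nat.eq_dec u w) as [Heq|Hne].
      - assert (Cmod (Z u w) <= INR V * 1); [|lra].
        apply Cmod_csum_bound. intros; rewrite Cmod_e; lra.
      - rewrite Rplus_0_l. apply Rle_div_r; [exact HU|].
        destruct (Rle_dec (INR V) (INR U * Cmod (Z u w))) as [Hle|]; [|lra].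
        exfalso. apply Hno. now exists u, w. }
    replace (INR U * (INR V + INR U * (INR V / INR U))) with (2 * INR U * INR V)
      in Hsum by (field; lra).
    unfold Z in Hsum.
    assert (H1 : S0 ^ 2 <= INR V * (2 * INR U * INR V)).
    { eapply Rle_trans; [exact Hcs|]. apply Rmult_le_compat_l; [lra|exact Hsum]. }
    assert (HX : 4 <= INR (q ^ t) ^ 2).
    { rewrite pow_INR. assert (INR q ^ 1 <= INR q ^ t) by (apply Rle_pow; lia || lra).
      rewrite pow_1 in *. nra. }
    set (X := INR (q ^ t)) in *.
    assert (HUX : INR U = X ^ 2 * X ^ 2).
    { unfold U, X. rewrite !pow_INR, <- !pow_mult, <- pow_add. f_equal. lia. }
    rewrite mult_INR in Hlarge.
    assert (H2 : (INR V * INR U) ^ 2 <= X ^ 2 * S0 ^ 2).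
    { rewrite <- Rpow_mult_distr. apply pow_incr. split; [|exact Hlarge].
      apply Rmult_le_pos; lra. }
    assert (H3 : (INR V * INR U) ^ 2 <= X ^ 2 * (INR V * (2 * INR U * INR V))).
    { eapply Rle_trans; [exact H2|]. apply Rmult_le_compat_l; [lra|exact H1]. }
    assert (H4 : INR U <= 2 * X ^ 2).
    { apply Rmult_le_reg_l with (INR V ^ 2 * INR U).
      - apply Rmult_lt_0_compat; [apply pow_lt|]; lra.
      - lra. }
    (* This reads [X ^ 4 <= 2 X ^ 2], against [4 <= X ^ 2]. *)
    rewrite HUX in H4. nra.
Qed.

(** * Large sums have leading coefficient close to a rational *)

(** With length [N = q ^ L], the power [q ^ t] plays the role of [N ^ eps]. The constant [c] is
    uniform in [t], [L] and the phase, so each differencing may multiply [t] by a constant. *)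
Definition major_arc (q : nat) (f : nat -> C) (D : nat) : Prop :=
  exists c : nat, forall (t L : nat) (b : R) (P : R -> R),
    (1 <= t)%nat -> poly_deg D b P ->
    INR q ^ L <= INR q ^ t * Cmod (csum (q ^ L) (fun n => (f n * e (P (INR n)))%C)) ->
    exists (B : nat) (A : Z), (1 <= B)%nat /\ INR B <= INR q ^ (c * t) /\
      INR q ^ L * Rabs (INR B * b - IZR A) <= INR q ^ (c * t).

Lemma major_arc_linear (q : nat) : (2 <= q)%nat -> major_arc q (fun _ => 1%C) 1.
Proof.
  intros Hq. exists 1%nat. intros t L b P Ht (c & T & HT & HP) Hlarge.
  assert (HQ : 2 <= INR q) by (change 2 with (INR 2); now apply le_INR).
  destruct (linear_sum_bound b c) as [k Hk]. specialize (Hk (q ^ L)%nat).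
  rewrite Nat.mul_1_l. exists 1%nat, k.
  split; [lia|]. split; [apply pow_R1_Rle; lra|].
  replace (INR 1 * b) with b by (simpl; ring).
  erewrite csum_ext in Hlarge.
  2:{ intros n _. rewrite Cmult_1_l, HP, (HT (INR n)), pow_1. reflexivity. }
  assert (0 < INR q ^ t) by (apply pow_lt; lra).
  pose proof (Rabs_pos (b - IZR k)).
  eapply Rle_trans; [apply Rmult_le_compat_r; [assumption|exact Hlarge]|].
  nra.
Qed.

(** After differencing, the hypothesis at [4 * t] and [L - 4 * t] approximates
    [S D * b * h * U ^ D]; the factors multiplying [b] are moved into the denominator. *)
Lemma major_arc_succ (q : nat) (f : nat -> C) (D : nat) :
  (2 <= q)%nat -> unimodular f -> q_multiplicative q f ->
  major_arc q (fun _ => 1%C) D -> major_arc q f (S D).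
Proof.
  intros Hq Hu Hf [c Hc].
  assert (HQ : 2 <= INR q) by (change 2 with (INR 2); now apply le_INR).
  (* The summands pay, in order, for [B], for [|h|], for the factor [S D <= q ^ (S D * t)], and for
     [U ^ D]. *)
  exists (4 * c + 4 + S D + 4 * D)%nat. intros t L b P Ht HP Hlarge.
  destruct (Nat.le_gt_cases (4 * t) L) as [HL|HL].
  (* For [L < 4 * t] the nearest integer suffices, with denominator [1]. *)
  2:{ destruct (exists_nearest_IZR b) as [k Hk].
      exists 1%nat, k. split; [lia|]. split; [apply pow_R1_Rle; lra|].
      replace (INR 1 * b) with b by (simpl; ring).
      apply Rle_trans with (INR q ^ L * 1).
      - apply Rmult_le_compat_l; [apply pow_le; lra|lra].
      - rewrite Rmult_1_r. apply Rle_pow; [lra|nia]. }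
  destruct (differencing q f D t L b P Hq Hu Hf Ht HL HP Hlarge)
    as (h & Hh0 & Hh & T & HT & HTlarge).
  destruct (fun H1 => Hc (4 * t)%nat (L - 4 * t)%nat _ T H1 HT)
    as (B & A & HB1 & HB & HA); [lia| |].
  { erewrite csum_ext; [exact HTlarge|]. intros; apply Cmult_1_l. }
  set (U := INR q ^ (4 * t)) in *.
  (* The denominator must be positive, so the sign of [h] goes to the numerator. *)
  exists (B * Z.abs_nat h * S D * (q ^ (4 * t)) ^ D)%nat, (Z.sgn h * A)%Z.
  assert (Habs : INR (Z.abs_nat h) = Rabs (IZR h)).
  { rewrite INR_IZR_INZ, Zabs2Nat.id_abs. apply abs_IZR. }
  assert (Hsgn : IZR (Z.abs h) = IZR (Z.sgn h) * IZR h).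
  { rewrite <- mult_IZR. f_equal. lia. }
  rewrite abs_IZR in Hsgn.
  assert (Hsgn1 : Rabs (IZR (Z.sgn h)) = 1).
  { rewrite <- abs_IZR. f_equal. lia. }
  split; [|split].
  - assert (1 <= Z.abs_nat h)%nat by lia.
    assert (1 <= (q ^ (4 * t)) ^ D)%nat.
    { rewrite <- Nat.pow_mul_r. apply Nat.neq_0_lt_0, Nat.pow_nonzero. lia. }
    assert (1 <= B * Z.abs_nat h)%nat by nia.
    assert (1 <= B * Z.abs_nat h * S D)%nat by nia. nia.
  - rewrite !mult_INR, !pow_INR, Habs. fold U.
    assert (HD : INR (S D) <= INR q ^ (S D * t)).
    { rewrite <- pow_INR. apply le_INR.
      apply Nat.le_trans with (q ^ S D)%nat.
      - apply Nat.lt_le_incl, Nat.pow_gt_lin_r. lia.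
      - apply Nat.pow_le_mono_r; nia. }
    replace ((4 * c + 4 + S D + 4 * D) * t)%nat
      with (c * (4 * t) + 4 * t + S D * t + 4 * t * D)%nat by ring.
    rewrite !pow_add, (pow_mult _ (4 * t) D). fold U.
    assert (0 <= U) by (apply pow_le; lra).
    pose proof (pos_INR B). pose proof (Rabs_pos (IZR h)). pose proof (pos_INR (S D)).
    repeat apply Rmult_le_compat; try assumption; try lra;
      repeat apply Rmult_le_pos; try assumption. now apply pow_le.
  - rewrite !mult_INR, !pow_INR, Habs, Hsgn, mult_IZR. fold U.
    replace (INR B * (IZR (Z.sgn h) * IZR h) * INR (S D) * U ^ D * b - IZR (Z.sgn h) * IZR A)
      with (IZR (Z.sgn h) * (INR B * (INR (S D) * b * IZR h * U ^ D) - IZR A)) by ring.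
    rewrite Rabs_mult, Hsgn1, Rmult_1_l.
    (* Returning from length [q ^ (L - 4 * t)] to [q ^ L] costs one more factor [U]. *)
    replace (INR q ^ L) with (INR q ^ (L - 4 * t) * U)
      by (unfold U; rewrite <- pow_add; f_equal; lia).
    apply Rle_trans with (INR q ^ (c * (4 * t)) * U).
    + rewrite (Rmult_comm _ U), Rmult_assoc, Rmult_comm.
      apply Rmult_le_compat_r; [apply pow_le; lra|exact HA].
    + unfold U. rewrite <- pow_add. apply Rle_pow; [lra|nia].
Qed.

(** The first differencing removes [f]; below it the induction runs with the constant weight [1],
    itself unimodular and [q]-multiplicative, down to the geometric sum. *)
Lemma major_arc_all (q : nat) (f : nat -> C) (D : nat) :
  (2 <= q)%nat -> unimodular f -> q_multiplicative q f -> major_arc q f (S (S D)).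
Proof.
  intros Hq Hu Hf. apply major_arc_succ; try assumption.
  clear f Hu Hf. induction D as [|D IH]; [now apply major_arc_linear|].
  apply major_arc_succ; try assumption.
  - intros n. apply Cmod_1.
  - intros t m n _ _. ring.
Qed.

(** * Induction on the degree *)

(** A power saving [N ^ (1 / r)] at lengths [N = q ^ L], written with integer exponents. *)
Definition uniform_saving (q : nat) (f : nat -> C) (D : nat) : Prop :=
  exists (r : nat) (K : R), (1 <= r)%nat /\ 0 <= K /\
    forall (t L : nat) (b : R) (P : R -> R), (r * t <= L)%nat -> poly_deg D b P ->
      INR q ^ t * Cmod (csum (q ^ L) (fun n => (f n * e (P (INR n)))%C)) <= K * INR q ^ L.

(** On the block starting at [v * q ^ k] the factor [f (v * q ^ k)] has modulus [1] and the phase is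
    shifted, hence uniformity in [h]. The last [r] terms are bounded trivially. *)
Lemma block_bound (q k M r : nat) (f : nat -> C) (P : R -> R) (X : R) :
  unimodular f -> q_multiplicative q f ->
  (forall h : R, Cmod (csum (q ^ k) (fun s => (f s * e (P (INR s + h)%R))%C)) <= X) ->
  Cmod (csum (M * q ^ k + r) (fun n => (f n * e (P (INR n)))%C)) <= INR M * X + INR r.
Proof.
  intros Hu Hf HX. rewrite csum_add.
  eapply Rle_trans; [apply Cmod_triangle|]. apply Rplus_le_compat.
  - rewrite csum_mul. apply Cmod_csum_bound. intros v _.
    erewrite csum_ext.
    2:{ intros u Hlt. cbv beta.
        rewrite (q_multiplicative_block q f k u v Hf Hlt), plus_INR.
        rewrite (Cmult_comm (f u)), <- Cmult_assoc. reflexivity. }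
    rewrite csum_mult_l, Cmod_mult, Hu, Rmult_1_l. apply HX.
  - rewrite <- (Rmult_1_r (INR r)). apply Cmod_csum_bound. intros n _.
    rewrite Cmod_mult, Hu, Cmod_e. lra.
Qed.

Lemma Cmod_twisted_avg (f : nat -> C) (phi : R -> R) (N : nat) :
  (1 <= N)%nat ->
  Cmod (csum N (fun n => (f n * e (phi (INR n)))%C)) = INR N * Cmod (twisted_avg f phi N).
Proof.
  intros HN. assert (0 < INR N) by (apply lt_0_INR; lia).
  unfold twisted_avg. rewrite Cmod_mult, Cmod_R, Rabs_pos_eq
    by (left; now apply Rinv_0_lt_compat).
  now field_simplify; [|lra].
Qed.

Lemma uniform_saving_linear (q : nat) (f : nat -> C) :
  (2 <= q)%nat -> gelfond_type f -> uniform_saving q f 1.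
Proof.
  intros Hq (c & Hc & K & HK).
  assert (HQ : 2 <= INR q) by (change 2 with (INR 2); now apply le_INR).
  (* With [r > 1 / c] and [r * t <= L], the Gelfond factor [q ^ (- c L)] is at most [q ^ (- t)]. *)
  destruct (INR_unbounded (/ c)) as [r Hr].
  assert (Hc' : 0 < / c) by now apply Rinv_0_lt_compat.
  exists r, K. split; [|split].
  - destruct r as [|r]; [simpl in Hr; lra|lia].
  (* The Gelfond bound at [N = 1] reads [|f 0| <= K] up to a phase, so [K] is nonnegative. *)
  - specialize (HK 1%nat (le_n _) 0).
    assert (H1 : Rpower (INR 1) (- c) = 1).
    { unfold Rpower. simpl. rewrite ln_1, Rmult_0_r. apply exp_0. }
    rewrite H1 in HK.
    pose proof (Cmod_ge_0 (twisted_avg f (fun x => x * 0) 1)). lra.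
  - intros t L b P HrL (c0 & T & HT & HP).
    assert (HqL : (1 <= q ^ L)%nat) by (apply Nat.neq_0_lt_0, Nat.pow_nonzero; lia).
    erewrite csum_ext.
    2:{ intros n _. rewrite HP, (HT (INR n)), pow_1, (Rmult_comm b), e_plus, Cmult_assoc.
        reflexivity. }
    rewrite csum_mult_r, Cmod_mult, Cmod_e, Rmult_1_r.
    rewrite (Cmod_twisted_avg f (fun x => x * b)) by exact HqL.
    specialize (HK (q ^ L)%nat HqL b). rewrite pow_INR in *.
    set (W := Cmod _) in *.
    assert (HQL : 0 < INR q ^ L) by (apply pow_lt; lra).
    assert (HQt : 0 < INR q ^ t) by (apply pow_lt; lra).
    assert (HW : 0 <= W) by apply Cmod_ge_0.
    assert (Hpow : INR q ^ t * Rpower (INR q ^ L) (- c) <= 1).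
    { rewrite <- !Rpower_pow, Rpower_mult, <- Rpower_plus by lra.
      rewrite <- (Rpower_O (INR q)) by lra. apply Rle_Rpower; [lra|].
      apply le_INR in HrL. rewrite mult_INR in HrL.
      assert (1 <= c * INR r).
      { apply Rmult_le_reg_l with (/ c); [lra|].
        rewrite <- Rmult_assoc, Rinv_l by lra. lra. }
      pose proof (pos_INR t). nra. }
    assert (HK0 : 0 <= K).
    { destruct (Rle_dec 0 K) as [|Hn]; [assumption|].
      assert (0 < Rpower (INR q ^ L) (- c)) by apply exp_pos. nra. }
    apply Rle_trans with (INR q ^ L * (K * (INR q ^ t * Rpower (INR q ^ L) (- c)))).
    + replace (INR q ^ t * (INR q ^ L * W)) with (INR q ^ L * (INR q ^ t * W)) by ring.
      apply Rmult_le_compat_l; [lra|]. nra.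
    + rewrite (Rmult_comm K (INR q ^ L)). apply Rmult_le_compat_l; [lra|]. nra.
Qed.

(* On an interval of length [N] a phase whose leading coefficient is close to [A / B] is, up to a
   small error, [B]-periodic times a phase of lower degree. *)
Lemma near_rational_bound (N B D : nat) (A : Z) (b X : R) (f : nat -> C) (P : R -> R) :
  unimodular f -> (0 < B)%nat -> poly_deg (S (S D)) b P ->
  (forall c T, poly_deg (S D) c T ->
    Cmod (csum N (fun s => (f s * e (T (INR s)))%C)) <= X) ->
  Cmod (csum N (fun s => (f s * e (P (INR s)))%C)) <=
  INR B * X + INR N * (8 * (Rabs (INR B * b - IZR A) * INR N ^ S (S D))).
Proof.
  intros Hu HB (c & T & HT & HP) HX.
  assert (HB1 : 1 <= INR B) by (change 1 with (INR 1); apply le_INR; lia).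
  erewrite csum_ext.
  2:{ intros s _. rewrite HP. rewrite Rplus_comm, e_plus, Cmult_assoc.
      replace (e (b * INR s ^ S (S D))) with
        (e (IZR A / INR B * INR s ^ S (S D)) +
         (e (b * INR s ^ S (S D)) - e (IZR A / INR B * INR s ^ S (S D))))%C by ring.
      apply Cmult_plus_distr_l. }
  rewrite csum_plus.
  eapply Rle_trans; [apply Cmod_triangle|]. apply Rplus_le_compat.
  - apply rational_phase_bound; [exact HB|]. intros j.
    destruct (poly_deg_linear D (INR j / INR B)) as [c' Hc'].
    erewrite csum_ext.
    2:{ intros s _. rewrite <- Cmult_assoc, <- e_plus.
        rewrite <- (Rmult_1_l (INR j / INR B * INR s)). reflexivity. }
    eapply (HX _ (fun x => T x + 1 * (INR j / INR B * x))).
    apply poly_deg_lin_comb; [exact HT|exact Hc'].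
  - apply Cmod_csum_bound. intros s Hs.
    rewrite !Cmod_mult, Hu, Cmod_e, !Rmult_1_l.
    eapply Rle_trans; [apply e_lipschitz|].
    apply Rmult_le_compat_l; [lra|].
    rewrite <- Rmult_minus_distr_r, Rabs_mult.
    rewrite (Rabs_pos_eq (INR s ^ _)) by apply pow_le, pos_INR.
    apply Rmult_le_compat.
    + apply Rabs_pos.
    + apply pow_le, pos_INR.
    (* Since [B >= 1], [|b - A / B| <= |B * b - A|]. *)
    + replace (INR B * b - IZR A) with (INR B * (b - IZR A / INR B)) by (field; lra).
      rewrite Rabs_mult, (Rabs_pos_eq (INR B)) by lra.
      pose proof (Rabs_pos (b - IZR A / INR B)). nra.
    + apply pow_incr. split; [apply pos_INR|]. apply le_INR. lia.
Qed.

Lemma uniform_saving_succ (q : nat) (f : nat -> C) (D : nat) :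
  (2 <= q)%nat -> unimodular f -> q_multiplicative q f ->
  uniform_saving q f (S D) -> uniform_saving q f (S (S D)).
Proof.
  intros Hq Hu Hf (r & K & Hr & HK & HrK).
  assert (HQ : 2 <= INR q) by (change 2 with (INR 2); now apply le_INR).
  assert (Hpos : forall n, 0 < INR q ^ n) by (intros; apply pow_lt; lra).
  destruct (major_arc_all q f D Hq Hu Hf) as [c Hc].
  (* This ensures [(c + 1) * t + S (S D) * L0 <= L] for the block exponent [L0] below, which
     controls the approximation error; the [8] is the Lipschitz constant of [e]. *)
  exists (c + 1 + S (S (S D)) * (r * (c + 1)))%nat, (K + 8).
  split; [lia|]. split; [lra|].
  intros t L b P HL HP.
  set (S0 := Cmod _).
  destruct (Rle_dec (INR q ^ L) (INR q ^ t * S0)) as [Hlarge|Hsmall].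
  2:{ specialize (Hpos L). nra. }
  (* [major_arc] requires [t >= 1]; at [t = 0] the trivial bound is enough. *)
  destruct (Nat.eq_dec t 0) as [->|Ht].
  { assert (S0 <= INR q ^ L * 1).
    { rewrite <- pow_INR. apply Cmod_csum_bound. intros.
      rewrite Cmod_mult, Hu, Cmod_e. lra. }
    specialize (Hpos L). simpl. nra. }
  destruct (Hc t L b P) as (B & A & HB1 & HB & HA); [lia|exact HP|exact Hlarge|].
  (* At this block length the induction hypothesis saves [q ^ ((c + 1) * t)]: the part [q ^ (c * t)]
     pays for [B], and [q ^ t] remains. *)
  set (L0 := (r * ((c + 1) * t))%nat).
  assert (HL0 : (L0 <= L)%nat) by (unfold L0; nia).
  set (X := (K + 8) * INR q ^ L0 / INR q ^ t).
  assert (HX : forall h : R,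
    Cmod (csum (q ^ L0) (fun s => (f s * e (P (INR s + h)%R))%C)) <= X).
  { intros h.
    eapply Rle_trans.
    { apply (near_rational_bound (q ^ L0) B D A b (K * INR q ^ L0 / INR q ^ ((c + 1) * t)) f
        (fun x => P (x + h)) Hu); [lia|now apply poly_deg_shift|].
      intros c' T HT. apply Rle_div_r; [apply Hpos|].
      rewrite Rmult_comm. now apply (HrK _ _ c'). }
    rewrite pow_INR, <- pow_mult.
    assert (H1 : INR B * (K * INR q ^ L0 / INR q ^ ((c + 1) * t)) <=
      K * INR q ^ L0 / INR q ^ t).
    { replace ((c + 1) * t)%nat with (c * t + t)%nat by ring. rewrite pow_add.
      pose proof (Hpos (c * t)%nat). pose proof (Hpos t). pose proof (Hpos L0).
      replace (K * INR q ^ L0 / INR q ^ t) with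
        (INR q ^ (c * t) * (K * INR q ^ L0 / (INR q ^ (c * t) * INR q ^ t))) by (field; lra).
      apply Rmult_le_compat_r; [|exact HB].
      apply Rmult_le_pos; [nra|]. left. apply Rinv_0_lt_compat. nra. }
    (* Replacing [b] by [A / B] inside a block costs [O(q ^ (- t))] per term. *)
    assert (H2 : Rabs (INR B * b - IZR A) * INR q ^ (L0 * S (S D)) <= / INR q ^ t).
    { apply Rmult_le_reg_l with (INR q ^ L * INR q ^ t).
      { apply Rmult_lt_0_compat; apply Hpos. }
      apply Rle_trans with (INR q ^ (c * t) * INR q ^ (L0 * S (S D)) * INR q ^ t).
      - replace (INR q ^ L * INR q ^ t * (Rabs (INR B * b - IZR A) * INR q ^ (L0 * S (S D))))
          with ((INR q ^ L * Rabs (INR B * b - IZR A)) * INR q ^ (L0 * S (S D)) * INR q ^ t)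
          by ring.
        repeat (apply Rmult_le_compat_r; [left; apply Hpos|]). exact HA.
      - rewrite (Rmult_assoc (INR q ^ L)), Rinv_r, Rmult_1_r by (specialize (Hpos t); lra).
        rewrite <- !pow_add. apply Rle_pow; [lra|]. unfold L0. nia. }
    unfold X. pose proof (Hpos L0) as H3.
    assert (H4 : INR q ^ L0 * (8 * (Rabs (INR B * b - IZR A) * INR q ^ (L0 * S (S D)))) <=
      INR q ^ L0 * (8 * / INR q ^ t)).
    { apply Rmult_le_compat_l; [lra|]. lra. }
    unfold Rdiv in *. lra. }
  assert (HS : S0 <= INR (q ^ (L - L0)) * X + INR 0).
  { assert (Hblock := block_bound q L0 (q ^ (L - L0)) 0 f P X Hu Hf HX).
    rewrite <- Nat.pow_add_r, Nat.add_0_r in Hblock.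
    replace (L - L0 + L0)%nat with L in Hblock by lia. exact Hblock. }
  simpl in HS. rewrite Rplus_0_r, pow_INR in HS.
  apply Rle_trans with (INR q ^ t * (INR q ^ (L - L0) * X)).
  - apply Rmult_le_compat_l; [left; apply Hpos|exact HS].
  - unfold X. replace L with (L - L0 + L0)%nat at 2 by lia. rewrite pow_add.
    right. field. apply Rgt_not_eq, Hpos.
Qed.

(** * From powers of [q] to arbitrary lengths *)

Lemma exists_pow_bracket (p N : nat) :
  (2 <= p)%nat -> (1 <= N)%nat -> exists k, (p ^ k <= N < p ^ S k)%nat.
Proof.
  intros Hp HN. induction HN as [|N HN [k Hk]].
  - exists 0%nat. simpl. lia.
  - destruct (Nat.lt_ge_cases (S N) (p ^ S k)) as [H|H].
    + exists k. lia.
    + exists (S k). split; [exact H|].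
      rewrite (Nat.pow_succ_r' p (S k)). nia.
Qed.

Lemma uniform_saving_all_lengths (q : nat) (f : nat -> C) (D : nat) :
  (2 <= q)%nat -> unimodular f -> q_multiplicative q f -> uniform_saving q f D ->
  exists c : R, 0 < c /\ exists K : R,
    forall (N : nat) (b : R) (P : R -> R), (1 <= N)%nat -> poly_deg D b P ->
      Cmod (twisted_avg f P N) <= K * Rpower (INR N) (- c).
Proof.
  intros Hq Hu Hf (r & K & Hr & HK & HrK).
  assert (HQ : 2 <= INR q) by (change 2 with (INR 2); now apply le_INR).
  assert (Hpos : forall n, 0 < INR q ^ n) by (intros; apply pow_lt; lra).
  assert (Hr0 : 0 < INR r) by (apply lt_0_INR; lia).
  (* From [N < q ^ (2 * (k + 1))] and [k + 1 <= r * (t + 1)] follows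
     [q ^ (- (t + 1)) <= N ^ (- 1 / (2 r))]; the factor [q] in the constant turns [t + 1] into
     [t]. *)
  exists (/ (2 * INR r)). split; [apply Rinv_0_lt_compat; lra|].
  exists ((K + 1) * INR q). intros N b P HN HP.
  assert (HN0 : 0 < INR N) by (apply lt_0_INR; lia).
  (* Base [q ^ 2] makes the block length [q ^ k] about [sqrt N], so the incomplete block has at most
     [q ^ k <= N / q ^ t] terms, as [t <= k]. *)
  destruct (exists_pow_bracket (q ^ 2) N) as (k & Hk1 & Hk2); [simpl; nia|exact HN|].
  rewrite <- Nat.pow_mul_r in Hk1, Hk2.
  apply le_INR in Hk1. apply lt_INR in Hk2. rewrite pow_INR in Hk1, Hk2.
  set (t := (k / r)%nat).
  assert (Ht1 : (r * t <= k)%nat) by (apply Nat.Div0.mul_div_le).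
  assert (Ht2 : (k < r * S t)%nat) by (apply Nat.mul_succ_div_gt; lia).
  assert (HX : forall h : R, Cmod (csum (q ^ k) (fun s => (f s * e (P (INR s + h)%R))%C))
    <= K * INR q ^ k / INR q ^ t).
  { intros h. apply Rle_div_r; [apply Hpos|]. rewrite Rmult_comm.
    apply (HrK t k b (fun x => P (x + h)) Ht1). now apply poly_deg_shift. }
  assert (Hblock := block_bound q k (N / q ^ k) (N mod q ^ k) f P _ Hu Hf HX).
  replace (N / q ^ k * q ^ k + N mod q ^ k)%nat with N in Hblock
    by (rewrite (Nat.div_mod_eq N (q ^ k)) at 1; ring).
  rewrite (Cmod_twisted_avg f P) in Hblock by exact HN.
  set (W := Cmod _) in *.
  assert (HM : INR (N / q ^ k) * INR q ^ k <= INR N).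
  { rewrite <- pow_INR, <- mult_INR. apply le_INR. rewrite Nat.mul_comm.
    apply Nat.Div0.mul_div_le. }
  assert (Hrem : INR (N mod q ^ k) <= INR N / INR q ^ t).
  { apply Rle_trans with (INR q ^ k).
    - rewrite <- pow_INR. apply le_INR, Nat.lt_le_incl, Nat.mod_upper_bound, Nat.pow_nonzero.
      lia.
    - apply Rle_div_r; [apply Hpos|]. rewrite <- pow_add.
      eapply Rle_trans; [|exact Hk1]. apply Rle_pow; [lra|nia]. }
  assert (HW : W <= (K + 1) / INR q ^ t).
  { apply Rmult_le_reg_l with (INR N); [exact HN0|].
    eapply Rle_trans; [exact Hblock|].
    assert (INR (N / q ^ k) * (K * INR q ^ k / INR q ^ t) <= INR N * (K / INR q ^ t)).
    { replace (INR (N / q ^ k) * (K * INR q ^ k / INR q ^ t))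
        with ((INR (N / q ^ k) * INR q ^ k) * (K / INR q ^ t))
        by (field; apply Rgt_not_eq, Hpos).
      apply Rmult_le_compat_r; [|exact HM].
      apply Rmult_le_pos; [exact HK|left; apply Rinv_0_lt_compat, Hpos]. }
    unfold Rdiv in *. lra. }
  eapply Rle_trans; [exact HW|].
  unfold Rdiv. rewrite Rmult_assoc. apply Rmult_le_compat_l; [lra|].
  rewrite Rpower_Ropp.
  replace (/ INR q ^ t) with (INR q * / INR q ^ S t).
  2:{ simpl. field. split; [apply Rgt_not_eq, Hpos|lra]. }
  apply Rmult_le_compat_l; [lra|]. apply Rinv_le_contravar; [apply exp_pos|].
  apply Rle_trans with (Rpower (INR q ^ (2 * r * S t)) (/ (2 * INR r))).
  - apply Rle_Rpower_l; [left; apply Rinv_0_lt_compat; lra|].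
    split; [exact HN0|]. left. eapply Rlt_le_trans; [exact Hk2|].
    apply Rle_pow; [lra|nia].
  - rewrite <- !Rpower_pow, Rpower_mult by lra.
    apply Rle_Rpower; [lra|]. right. rewrite !mult_INR.
    change (INR 2) with 2. field. lra.
Qed.

Theorem theoremA (q : nat) (f : nat -> C) :
  (2 <= q)%nat ->
  unimodular f ->
  q_multiplicative q f ->
  gelfond_type f ->
  forall d : nat, (1 <= d)%nat ->
    exists cd : R, 0 < cd /\ exists K : R,
      forall N : nat, (1 <= N)%nat -> forall a : nat -> R,
        Cmod (twisted_avg f (poly_eval d a) N) <= K * Rpower (INR N) (- cd).
Proof.
  intros Hq Hu Hf Hg d Hd.
  assert (Hsaving : uniform_saving q f d).
  { induction Hd as [|d Hd IH]; [now apply uniform_saving_linear|].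
    destruct d as [|d]; [lia|]. now apply uniform_saving_succ. }
  destruct (uniform_saving_all_lengths q f d Hq Hu Hf Hsaving) as (c & Hc & K & HK).
  exists c. split; [exact Hc|]. exists K. intros N HN a.
  apply (HK N (a d)); [exact HN|apply poly_deg_poly_eval].
Qed.
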